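(* For any Banach space $X$ with $\dim X\ge 2$, $$4\,(1-\delta_{X}(1))^2\ge G_L(X)-4.$$
   Context: $S_X=\{x\in X:\|x\|=1\}$ denotes the unit sphere of $X$. For a Banach space $X$ with $\dim X\ge 2$, the constant $G_L(X)$ is defined by $$G_L(X)=\sup\{\|x+y\|^{2}+\|2x-y\|^{2}: x,y\in X,\ \|x\|=\|y\|=\|x-y\|=1\}.$$ The Clarkson modulus of convexity of $X$ is $$\delta_X(\epsilon)=\inf\left\{1-\frac{\|x+y\|}{2}: x,y\in S_X,\ \|x-y\|\ge \epsilon\right\},\qquad 0\le\epsilon\le 2.$$ *)

(* Defs.v *)
From HB Require Import structures.
From mathcomp Require Import all_boot all_order all_algebra.
From mathcomp Require Import all_classical all_reals all_analysis.
Set Implicit Arguments.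
Unset Strict Implicit.
Unset Printing Implicit Defensive.
Import Order.TTheory GRing.Theory Num.Theory.
Import numFieldNormedType.Exports.
Local Open Scope classical_set_scope.
Local Open Scope ring_scope.

(* dim V >= n, for V possibly infinite-dimensional: V contains n linearly
   independent vectors. *)
Definition dim_ge (R : fieldType) (V : lmodType R) (n : nat) : Prop :=
  exists v : 'I_n -> V, forall a : 'I_n -> R,
    \sum_(i < n) a i *: v i = 0 -> forall i, a i = 0.

Definition unit_sphere (R : realType) (X : normedModType R) : set X :=
  [set x : X | `|x| = 1].

(* For dim X >= 2 the set below is nonempty and bounded by 8, so the real-valued
   [sup] is the actual least upper bound. *)
Definition G_L (R : realType) (X : normedModType R) : R :=
  sup [set r : R | exists x y : X,
    [/\ `|x| = 1, `|y| = 1, `|x - y| = 1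
      & r = `|x + y| ^+ 2 + `|2 *: x - y| ^+ 2]].

(* Meaningful for 0 <= eps <= 2: if X is not the zero space the set below is then
   nonempty (take y = - x) and bounded below by 0, so the real-valued [inf] is
   the actual greatest lower bound; for eps > 2 the set is empty. *)
Definition clarkson_modulus (R : realType) (X : normedModType R) (eps : R) : R :=
  inf [set r : R | exists x y : X,
    [/\ unit_sphere x, unit_sphere y, eps <= `|x - y|
      & r = 1 - `|x + y| / 2]].

Arguments G_L {R} X.
Arguments clarkson_modulus {R} X eps.

(* Main.v *)
Require Import Defs.
From HB Require Import structures.
From mathcomp Require Import all_boot all_order all_algebra.
From mathcomp Require Import all_classical all_reals all_analysis.
From mathcomp Require Import lra.
Import Order.TTheory GRing.Theory Num.Theory.
Import numFieldNormedType.Exports.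
Local Open Scope ring_scope.

(** Let [x], [y], [x - y] be unit vectors.  Both terms in the supremum defining
    [G_L X] are norms of sums of two unit vectors at distance 1: this is plain
    for [x + y], and [2 x - y = x + (x - y)] where [x - (x - y) = y].  Each of
    them is therefore at most 2 by the triangle inequality, and at most
    [2 (1 - delta)], with [delta] the modulus of convexity at 1
    ([norm_add_le_clarkson]).  Using the trivial bound for one term and the
    modulus for the other bounds the sum of squares by
    [4 + 4 (1 - delta) ^ 2]. *)

Lemma norm_add_unit_le2 (R : realType) (X : normedModType R) (x y : X) :
  `|x| = 1 -> `|y| = 1 -> `|x + y| <= 2.
Proof. by move=> nx ny; have := ler_normD x y; rewrite nx ny. Qed.

(** The real-valued [inf] is a lower bound only for a set that is bounded
    below; here the triangle inequality supplies the bound 0. *)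
Lemma norm_add_le_clarkson (R : realType) (X : normedModType R) (e : R)
    (x y : X) :
  `|x| = 1 -> `|y| = 1 -> e <= `|x - y| ->
  `|x + y| <= 2 * (1 - clarkson_modulus X e).
Proof.
move=> nx ny exy.
have : clarkson_modulus X e <= 1 - `|x + y| / 2.
  apply: ge_inf; last by exists x, y.
  exists 0 => _ [u [v [nu nv _ ->]]].
  by have := norm_add_unit_le2 _ _ _ _ nu nv; lra.
by lra.
Qed.

Theorem proposition3p8 (R : realType) (X : completeNormedModType R)
  (dimX : dim_ge X 2) :
  4 * (1 - clarkson_modulus X 1) ^+ 2 >= G_L X - 4.
Proof.
set c := 1 - clarkson_modulus X 1.
have sq_ge0 : 0 <= c ^+ 2 by exact: sqr_ge0.
rewrite lerBlDr /G_L; set S := (X in sup X).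
(* [ge_sup] asks for a nonempty set; the [sup] of the empty set is 0 by
   convention. *)
have [S0|/set0P S_neq0] := eqVneq S set0.
  by rewrite S0 sup0; lra.
apply: ge_sup => // _ [x [y [nx ny nxy ->]]].
apply: lerD.
  have -> : 4 * c ^+ 2 = (2 * c) ^+ 2 by rewrite exprMn -natrX.
  rewrite lerXn2r ?nnegrE //; last by apply: norm_add_le_clarkson; rewrite ?nxy.
  apply: le_trans (normr_ge0 (x + y)) _.
  by apply: norm_add_le_clarkson; rewrite ?nxy.
have -> : 2 *: x - y = x + (x - y) by rewrite scaler_nat mulr2n addrA.
have -> : 4 = 2 ^+ 2 :> R by rewrite -natrX.
by rewrite lerXn2r ?nnegrE // norm_add_unit_le2.
Qed.
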